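(* Let $\vec{c}\in\{-1,1\}^n$ with $c_1=1$, and let $A=(a_{ij})\in M_{n,n}(\mathbb{R})$ satisfy $\varphi_{\vec{c}}(A)=-A$. Let $i_1<i_2<\cdots<i_r$ be all the indices $i$ with $c_i=1$ (so $1\le r\le n$) and let $j_1<j_2<\cdots<j_{n-r}$ be all the indices $j$ with $c_j=-1$. Let $F=(f_{lm})\in M_{r,n-r}(\mathbb{R})$ be given by $f_{lm}=a_{i_l j_m}$ for $1\le l\le r$, $1\le m\le n-r$, and let $G=(g_{lm})\in M_{n-r,r}(\mathbb{R})$ be given by $g_{lm}=a_{j_l i_m}$ for $1\le l\le n-r$, $1\le m\le r$. Let $H$ be the block matrix $$H=\begin{pmatrix} O_r & F\\ G & O_{n-r}\end{pmatrix},$$ where $O_r\in M_{r,r}(\mathbb{R})$ and $O_{n-r}\in M_{n-r,n-r}(\mathbb{R})$ are zero matrices. Then $A$ is permutation similar to $H$.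
   Context: $M_{p,q}(\mathbb{R})$ is the set of real $p\times q$ matrices. For $\vec{c}=(c_1,\ldots,c_n)\in\{-1,1\}^n$ with $c_1=1$, the map $\varphi_{\vec{c}}:M_{n,n}(\mathbb{R})\to M_{n,n}(\mathbb{R})$ is defined by $(\varphi_{\vec{c}}(A))_{ij}=c_i\,a_{ij}\,c_j$. Matrices $A,B\in M_{n,n}(\mathbb{R})$ are permutation similar if $B=P^{-1}AP$ for some permutation matrix $P$. When $r=n$ the blocks $F$, $G$, $O_{n-r}$ are empty and $H=O_n$. *)

(* Defs.v *)
From mathcomp Require Import all_boot all_order all_algebra.
From mathcomp Require Import reals.

Set Implicit Arguments.
Unset Strict Implicit.
Unset Printing Implicit Defensive.

Import GRing.Theory.
Local Open Scope ring_scope.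

Definition sign_vector (R : realType) (n : nat) (c : 'rV[R]_n) : Prop :=
  forall k : 'I_n, c 0 k = -1 \/ c 0 k = 1.

Definition phi (R : realType) (n : nat) (c : 'rV[R]_n) (A : 'M[R]_n) : 'M[R]_n :=
  \matrix_(i, j) (c 0 i * A i j * c 0 j).

Definition perm_similar (R : realType) (n : nat) (A B : 'M[R]_n) : Prop :=
  exists2 P : 'M[R]_n, is_perm_mx P & B = invmx P *m A *m P.

Definition increasing_enum (n r : nat) (i : 'I_r -> 'I_n) (p : 'I_n -> Prop) : Prop :=
  (forall l m : 'I_r, (l < m)%N -> (i l < i m)%N) /\
  (forall k : 'I_n, p k <-> exists l : 'I_r, i l = k).

(* Main.v *)
(** The entry [A k l] is multiplied by [c_k c_l] under [phi c], so it vanishes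
    whenever [c_k = c_l].  Listing the indices with [c = 1] first and those with
    [c = -1] next is a permutation, and reindexing [A] by it yields the blocks. *)

Require Import Defs.
From mathcomp Require Import all_boot all_order all_algebra.
From mathcomp Require Import reals.
From mathcomp Require Import fingroup perm.

Set Implicit Arguments.
Unset Strict Implicit.
Unset Printing Implicit Defensive.

Import GRing.Theory.
Local Open Scope ring_scope.

Lemma increasing_enum_inj (n r : nat) (i : 'I_r -> 'I_n) (p : 'I_n -> Prop) :
  increasing_enum i p -> injective i.
Proof.
move=> [incr_i _] l m eq_lm; apply: val_inj; case: (ltngtP l m) => // lt_lm.
  by have := incr_i _ _ lt_lm; rewrite eq_lm ltnn.
by have := incr_i _ _ lt_lm; rewrite eq_lm ltnn.
Qed.

(** An injective self-map of ['I_n] is a permutation, so reindexing rows and columns by it is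
    conjugation by a permutation matrix. *)
Lemma perm_similar_mxsub (R : realType) (n : nat) (A : 'M[R]_n) (f : 'I_n -> 'I_n) :
  injective f -> perm_similar A (mxsub f f A).
Proof.
(* Left multiplication by [perm_mx s] reindexes rows by [s], while columns are reindexed by right
   multiplication by [perm_mx s^-1]; hence the inverse in the witness. *)
move=> f_inj; exists (perm_mx (perm f_inj)^-1); first exact: perm_mx_is_perm.
have -> : invmx (perm_mx (perm f_inj)^-1) = perm_mx (perm f_inj) :> 'M[R]_n.
  rewrite -[LHS]mulmx1 -[X in _ *m X = _](perm_mx1 R n) -(mulVg (perm f_inj)).
  by rewrite perm_mxM mulKmx // unitmx_perm.
rewrite -row_permE -col_permE; apply/matrixP => k l.
by rewrite !mxE !permE.
Qed.

(** Equal signs have product 1, so the hypothesis reads [A k l = - A k l]. *)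
Lemma phi_opp_entry0 (R : realType) (n : nat) (c : 'rV[R]_n) (A : 'M[R]_n)
    (k l : 'I_n) :
  sign_vector c -> phi c A = - A -> c 0 k = c 0 l -> A k l = 0.
Proof.
move=> hc /matrixP/(_ k l); rewrite !mxE => + ckl.
rewrite ckl; case: (hc l) => ->; rewrite ?mulN1r ?mulrN1 ?opprK ?mul1r ?mulr1;
  by move/eqP; rewrite eq_sym Num.Theory.eqNr => /eqP.
Qed.

Theorem theorem16 (R : realType) (n : nat) (hn : (0 < n)%N)
  (c : 'rV[R]_n) (hc : sign_vector c) (hc1 : c 0 (Ordinal hn) = 1)
  (A : 'M[R]_n) (hA : phi c A = - A)
  (r : nat) (hr : (r <= n)%N)
  (i : 'I_r -> 'I_n) (hi : increasing_enum i (fun k => c 0 k = 1))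
  (j : 'I_(n - r) -> 'I_n) (hj : increasing_enum j (fun k => c 0 k = -1)) :
  let F := \matrix_(l < r, m < n - r) A (i l) (j m) in
  let G := \matrix_(l < n - r, m < r) A (j l) (i m) in
  let H : 'M[R]_(r + (n - r)) := block_mx 0 F G 0 in
  perm_similar A (castmx (subnKC hr, subnKC hr) H).
Proof.
move=> F G H.
have ci l : c 0 (i l) = 1 by apply/hi.2; exists l.
have cj m : c 0 (j m) = -1 by apply/hj.2; exists m.
have c_neq l m : i l <> j m.
  move=> eq_lm; have := ci l; rewrite eq_lm cj => /eqP.
  by rewrite Num.Theory.eqNr oner_eq0.
(* The first [r] positions are sent through [i], the remaining [n - r] through [j]. *)
pose f (k : 'I_n) : 'I_n :=
  match split (cast_ord (esym (subnKC hr)) k) with inl l => i l | inr m => j m end.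
have f_inj : injective f.
  move=> k k' eq_f; apply: (@cast_ord_inj _ _ (esym (subnKC hr))).
  apply: (can_inj (@splitK _ _)); move: eq_f; rewrite /f.
  case: split => a; case: split => b.
  - by move/(increasing_enum_inj hi) ->.
  - by move/c_neq.
  - by move/esym/c_neq.
  - by move/(increasing_enum_inj hj) ->.
suff -> : castmx (subnKC hr, subnKC hr) H = mxsub f f A.
  exact: perm_similar_mxsub.
apply/matrixP => k l; rewrite castmxE /= !mxE /f.
(* Off-diagonal blocks agree by definition of [F] and [G]; in the diagonal blocks both indices carry
   the same sign. *)
case: split => a; rewrite !mxE; case: split => b; rewrite !mxE //;
  by rewrite (phi_opp_entry0 hc hA) ?ci ?cj.
Qed.
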